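(* Assume Martin's Axiom and $2^{\aleph_0} > \aleph_1$. Then there is no universal set.
   Context: A set $Y \subseteq \mathbb{C}$ with $|Y| < 2^{\aleph_0}$ is called universal (for entire functions) if for every $X \subseteq \mathbb{C}$ with $|X| < 2^{\aleph_0}$ there is a non-constant entire function $f\colon\mathbb{C}\to\mathbb{C}$ with $f(X) \subseteq Y$. Martin's Axiom: for every ccc partial order $\mathbb{P}$ and every family of fewer than $2^{\aleph_0}$ dense subsets of $\mathbb{P}$ there is a filter meeting all of them. *)

(* Defs.v *)
From HB Require Import structures.
From mathcomp Require Import all_boot all_order all_algebra.
From mathcomp Require Import complex.
From mathcomp Require Import boolp classical_sets functions cardinality.
From mathcomp Require Import reals topology normedtype derive.

Set Implicit Arguments.
Unset Strict Implicit.
Unset Printing Implicit Defensive.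

Import Order.TTheory GRing.Theory Num.Theory.
Import numFieldNormedType.Exports.

Local Open Scope classical_set_scope.
Local Open Scope card_scope.
Local Open Scope ring_scope.

Definition card_lt (T U : Type) (A : set T) (B : set U) : Prop :=
  A #<= B /\ ~ (B #<= A).

Definition continuum : set (set nat) := [set: set nat].

(* |A| is aleph_1, i.e. the least uncountable cardinal *)
Definition card_aleph1 (T : Type) (A : set T) : Prop :=
  ~ countable A /\ forall (U : Type) (B : set U), ~ countable B -> A #<= B.

Definition aleph1_lt_continuum : Prop :=
  exists (T : Type) (A : set T), card_aleph1 A /\ card_lt A continuum.

Section Forcing.
Context (d : Order.disp_t) (P : porderType d).

Definition compatible (p q : P) : Prop := exists r, (r <= p)%O /\ (r <= q)%O.

Definition antichain (A : set P) : Prop :=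
  forall p q, A p -> A q -> p <> q -> ~ compatible p q.

Definition ccc : Prop := forall A : set P, antichain A -> countable A.

Definition forcing_dense (D : set P) : Prop :=
  forall p, exists q, D q /\ (q <= p)%O.

Definition forcing_filter (G : set P) : Prop :=
  [/\ G !=set0,
      forall p q, G p -> (p <= q)%O -> G q
    & forall p q, G p -> G q -> exists r, [/\ G r, (r <= p)%O & (r <= q)%O]].

End Forcing.

(* Nonemptiness of P is the usual implicit convention: without it the empty
   order would refute the axiom, as filters are nonempty. *)
Definition Martin_axiom : Prop :=
  forall (d : Order.disp_t) (P : porderType d), [set: P] !=set0 -> ccc P ->
  forall DD : set (set P), card_lt DD continuum ->
  (forall D, DD D -> forcing_dense D) ->
  exists G : set P, forcing_filter G /\ forall D, DD D -> G `&` D !=set0.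

Section Universal.
Context (R : realType).

(* Complex differentiability: the difference quotient in the direction 1 is
   taken over the scalar field R[i], so the increment h ranges over R[i]. *)
Definition entire (f : R[i] -> R[i]) : Prop :=
  forall z : R[i], derivable (f : R[i]^o -> R[i]^o) z 1.

Definition universal (Y : set R[i]) : Prop :=
  card_lt Y continuum /\
  forall X : set R[i], card_lt X continuum ->
  exists f : R[i] -> R[i],
    [/\ entire f, ~ (exists c, forall z, f z = c) & f @` X `<=` Y].

End Universal.

(* Main.v *)
(* Under Martin's Axiom a set Y of size < c is a countable union of sets Y_n such that all
   distances occurring in Y_n avoid the intervals [w_k/(k+1), (k+1) w_k] for k >= n, for a
   suitable sequence of scales w_k = 4^-(m_k): the forcing approximates, for each k, finitely
   many points by well separated rational points (this is the localization property of
   slaloms).  Conversely the sums of 4^-i over i in S, for S a set of exponents m_k, have all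
   their distances comparable to some w_k.
   Let X consist of aleph_1 many such sums and their rational translates.  If f is entire and
   f(X) is contained in Y, then some x in X is an accumulation point of points x' in X with
   f(x), f(x') in the same Y_n; if f'(x) <> 0 then |f(x) - f(x')| is comparable to
   |x - x'|, which contradicts the choice of the gaps.  By the translates, f' would vanish on
   a dense set, so f would be constant because f' is continuous.  The latter follows from
   Goursat's lemma through the Cauchy estimate |f'(a)| <= max |f(a + u) - f(a)| over |u| = 1,
   applied to z |-> f(z + h) - f(z). *)

From HB Require Import structures.
Require Import Defs.
From mathcomp Require Import all_boot all_order all_algebra complex.
From mathcomp Require Import boolp classical_sets functions cardinality.
From mathcomp Require Import reals topology normedtype derive sequences exp trigo.
From mathcomp Require Import measure lebesgue_measure lebesgue_integral ftc.
From mathcomp Require Import ring lra.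

Set Implicit Arguments.
Unset Strict Implicit.
Unset Printing Implicit Defensive.

Import Order.TTheory GRing.Theory Num.Theory.
Import numFieldNormedType.Exports.
Import Normc.

Local Open Scope classical_set_scope.
Local Open Scope card_scope.

(** * Cardinality *)

(** Turns an injection between subtypes into a total function; [a0] supplies the value outside
    [A]. *)
Lemma card_le_fun (T U : Type) (A : set T) (B : set U) (a0 : T) : A a0 ->
  A #<= B ->
  exists f : T -> U, (forall x, A x -> B (f x)) /\ {in A &, injective f}.
Proof.
move=> Aa0 /card_leP[f].
exists (fun x => if pselect (A x) is left h
                 then set_val (f (SigSub (mem_set h)))
                 else set_val (f (SigSub (mem_set Aa0)))); split.
  by move=> x Ax; case: pselect => // h; exact: set_valP.
move=> x y /set_mem Ax /set_mem Ay; case: pselect => // hx; case: pselect => // hy.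
by move=> /val_inj /inj; rewrite !inE => /(_ I I) [].
Qed.

Lemma card_le_inj (T U : Type) (A : set T) (B : set U) (f : T -> U) :
  (forall x, A x -> B (f x)) -> {in A &, injective f} -> A #<= B.
Proof.
move=> fAB /inj_card_eq; rewrite card_eq_sym card_eq_le => /andP[h _].
by apply: card_le_trans h _; apply: subset_card_le => _ [x Ax <-]; exact: fAB.
Qed.

(* Koenig's argument: coding sequences of sets by sets, each A n omits a value c n at
   the n-th coordinate, so no A n contains the code of the sequence c. *)
Lemma continuum_bigcup (T : Type) (A : nat -> set T) :
  continuum #<= \bigcup_n A n -> exists n, continuum #<= A n.
Proof.
move=> /(card_le_fun (I : continuum set0))[g [gA ginj]]; apply: contrapT => nA.
pose code (s : nat -> set nat) : set nat :=
  [set pickle p | p in [set p : nat * nat | s p.1 p.2]].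
have codeP s n k : code s (pickle (n, k)) <-> s n k.
  split=> [[[n' k'] /= sn /(pcan_inj pickleK)[<- <-]] //|snk].
  by exists (n, k).
have codeI : injective code.
  move=> s s' e; apply/funext => n; apply/funext => k; apply/propext.
  by rewrite -!codeP e.
(* If every [c] were the [n]-th coordinate of some [s] with [g (code s)] in [A n], choosing such an
   [s] for each [c] would inject the continuum into [A n]. *)
have /choice[c cP] : forall n, exists c, forall s, A n (g (code s)) -> s n <> c.
  move=> n; apply: contrapT => nc; apply: nA; exists n.
  have /choice[sel selP] : forall c, exists s, A n (g (code s)) /\ s n = c.
    move=> c; apply: contrapT => ns; apply: nc; exists c => s As sc.
    by apply: ns; exists s.
  apply: (@card_le_inj _ _ _ _ (fun c => g (code (sel c)))).
    by move=> c _; have [] := selP c.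
  move=> c c' _ _ /ginj; rewrite !inE => /(_ I I)/codeI e.
  by have [_ <-] := selP c; have [_ <-] := selP c'; rewrite e.
by have [n _ /cP] := gA (code c) I.
Qed.

(** * Localization from Martin's Axiom *)

Section LocalizationForcing.
Context (K : countType) (T : choiceType) (A : T -> nat -> K -> Prop).

(** A condition is a finite initial segment of the sequence sought, with finitely many points whose
    constraints bind all later entries. The ignored argument lets the order instance on this type
    depend on [A]. *)
Definition cond of (T -> nat -> K -> Prop) := (seq K * seq T)%type.
Local Notation P := (cond A).
HB.instance Definition _ := Choice.on P.

(* Proper extensions lengthen the first component strictly: this makes the order
   antisymmetric although the second component is a list representing a finite set. *)
Definition extends (p q : P) : Prop :=
  [/\ (size q.1 < size p.1)%N,
      forall i, (i < size q.1)%N -> onth p.1 i = onth q.1 i,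
      {subset q.2 <= p.2}
    & forall y i t, y \in q.2 -> (size q.1 <= i)%N -> onth p.1 i = Some t ->
        A y i t].

Definition cond_le (p q : P) : bool := `[< p = q \/ extends p q >].

Lemma extends_trans p q r : extends p q -> extends q r -> extends p r.
Proof.
move=> [pq1 pq2 pq3 pq4] [qr1 qr2 qr3 qr4]; split.
- exact: ltn_trans qr1 pq1.
- by move=> i ir; rewrite pq2 ?qr2// (ltn_trans ir).
- by move=> y /qr3/pq3.
- move=> y i t yr ir pit.
  have [iq|qi] := ltnP i (size q.1); first by apply: qr4 => //; rewrite -pq2.
  by apply: pq4 => //; exact: qr3.
Qed.

Lemma cond_le_refl : reflexive cond_le.
Proof. by move=> p; apply/asboolP; left. Qed.

Lemma cond_le_anti : antisymmetric cond_le.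
Proof.
move=> p q /andP[/asboolP[//|[pq _ _ _]] /asboolP[//|[qp _ _ _]]].
by have := ltn_trans pq qp; rewrite ltnn.
Qed.

Lemma cond_le_trans : transitive cond_le.
Proof.
move=> q p r /asboolP[->//|pq] /asboolP[<-|qr]; apply/asboolP; right => //.
exact: extends_trans pq qr.
Qed.

Fact cond_display : Order.disp_t. Proof. exact: Order.Disp tt tt. Qed.
HB.instance Definition _ := Order.Le_isPOrder.Build cond_display P
  cond_le_refl cond_le_anti cond_le_trans.

Lemma condP (p q : P) : (p <= q)%O <-> p = q \/ extends p q.
Proof. by split=> [/asboolP|?]; last exact/asboolP. Qed.

Context (fip : forall (F : seq T) k, exists t, forall y, y \in F -> A y k t).

(** New entries are tested only against [q.2], so one entry given by [fip] suffices, and further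
    points can be added at the same time. *)
Lemma extends_by (p q : P) : {subset q.2 <= p.2} -> q.1 = p.1 ->
  exists t, extends (rcons p.1 t, p.2) q.
Proof.
move=> qp e; have [t tP] := fip q.2 (size q.1).
exists t; split => //=.
- by rewrite size_rcons e.
- by move=> i iq; rewrite -cats1 onth_cat -e iq.
- move=> y i u yq iq; rewrite -cats1 onth_cat -e ltnNge iq /= => /onth1P[/eqP].
  rewrite subn_eq0 => qi <-.
  by rewrite (_ : i = size q.1); [exact: tP|apply/eqP; rewrite eqn_leq qi].
Qed.

(** Conditions with the same first component are compatible: join their lists of points and append
    one entry serving both. As [K] is countable, there are only countably many first components. *)
Lemma cond_ccc : ccc P.
Proof.
move=> B anti.
suff /inj_card_eq : {in B &, injective (fun p : P => p.1)}.
  by rewrite card_eq_le => /andP[_ h]; exact: (card_le_trans h (countableP _)).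
move=> p q /set_mem Bp /set_mem Bq e; apply: contrapT => npq.
apply: (anti _ _ Bp Bq npq).
have [t [r1 r2 r3 r4]] := @extends_by (p.1, p.2 ++ q.2) (p.1, p.2 ++ q.2)
  (fun _ => id) erefl.
exists (rcons p.1 t, p.2 ++ q.2); split; apply/condP; right; split => //=.
- by move=> y yp; rewrite mem_cat yp.
- by move=> y i u yp; apply: r4; rewrite mem_cat yp.
- by rewrite -e.
- by move=> i; rewrite -e; exact: r2.
- by move=> y yp; rewrite mem_cat yp orbT.
- by move=> y i u yp; rewrite -e; apply: r4; rewrite mem_cat yp orbT.
Qed.

Lemma dense_ge (y : T) n :
  forcing_dense [set p : P | y \in p.2 /\ (n <= size p.1)%N].
Proof.
move=> p; elim: n => [|n [q [[yq nq] qp]]].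
  have [t h] := @extends_by (p.1, y :: p.2) p
    (fun z => mem_behead (s := y :: p.2) (x := z)) erefl.
  exists (rcons p.1 t, y :: p.2); split; last by apply/condP; right.
  by split; rewrite //= mem_head.
have [t h] := @extends_by q q (fun _ => id) erefl.
exists (rcons q.1 t, q.2); split.
  by split => //=; rewrite size_rcons.
by apply: le_trans qp; apply/condP; right.
Qed.

(** The entry [t k] is read off some condition in the filter. If [p] in the filter lists [y], a
    common lower bound of [p] and that condition shows that [t k] obeys the constraint of [y] once
    [k] is at least the length of [p.1]. *)
Lemma generic_localization (G : set P) (Y : set T) : forcing_filter G ->
  (forall n, exists2 p, G p & (n < size p.1)%N) ->
  (forall y, Y y -> exists2 p, G p & y \in p.2) ->
  exists t : nat -> K, forall y, Y y ->
    exists n, forall k, (n <= k)%N -> A y k (t k).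
Proof.
move=> [_ _ Gdir] Glong GY.
have ext : forall n, exists t, exists2 p, G p & onth p.1 n = Some t.
  move=> n; have [p Gp np] := Glong n.
  case e : (onth p.1 n) => [t|]; first by exists t; exists p.
  by move: np; rewrite -onthTE e.
have [t tP] := choice ext.
exists t => y /GY [p Gp yp]; exists (size p.1) => k pk.
have [q Gq qk] := tP k.
have [r [Gr rp rq]] := Gdir _ _ Gp Gq.
have rk : onth r.1 k = Some (t k).
  move/condP : rq => [->//|[_ h _ _]]; rewrite h //.
  by rewrite -onthTE qk.
(* The case [r = p] is impossible, since [p.1] has no entry at [k]. *)
move/condP : rp => [e|[_ _ _ h]]; last exact: h rk.
by move: rk; rewrite e onth_default.
Qed.

End LocalizationForcing.

(** One dense set per point of [Y] keeps the family below the continuum. A finite [Y] has too few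
    points to force infinite length and is settled by the hypothesis directly. *)
Lemma Martin_localization (K : countType) (T : choiceType) (Y : set T)
    (A : T -> nat -> K -> Prop) :
  Martin_axiom -> card_lt Y continuum ->
  (forall (F : seq T), {in F, forall y, Y y} ->
     forall k, exists t, {in F, forall y, A y k t}) ->
  exists t : nat -> K, forall y, Y y ->
    exists n, forall k, (n <= k)%N -> A y k (t k).
Proof.
move=> MA [Yc cY] fip.
have [finY|infY] := pselect (finite_set Y).
  have [F YF] := (finite_seqP Y).1 finY.
  have {}fip : forall k, exists t, {in F, forall y, A y k t}.
    by apply: fip => y yF; rewrite YF.
  have [t tP] := choice fip.
  by exists t => y; rewrite YF => yF; exists 0%N => k _; exact: tP.
(* Trivial constraints off [Y] extend finite satisfiability to all lists in [T]. *)
pose A' y k t := Y y -> A y k t.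
have fip' : forall (F : seq T) k, exists t, forall y, y \in F -> A' y k t.
  move=> F k; have [|t tP] := fip [seq y <- F | `[<Y y>]] _ k.
    by move=> y; rewrite mem_filter => /andP[/asboolP].
  by exists t => y yF Yy; apply: tP; rewrite mem_filter yF andbT; exact/asboolP.
have /infiniteP/(card_le_fun (I : [set: nat] 0%N))[f [fY finj]] := infY.
(* [rank] maps [Y] onto the natural numbers, so the sets [D y] also force conditions of every
   length. *)
pose rank y := xget 0%N [set n | f n = y].
have rankf n : rank (f n) = n.
  rewrite /rank; case: xgetP => [m _ /= e|/(_ n)/(_ erefl)]; last by [].
  by apply: finj e; rewrite inE.
pose D y := [set p : cond A' | y \in p.2 /\ (rank y < size p.1)%N].
have [||||G [Gf GD]] := MA _ (cond A') _ _ (D @` Y).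
- by exists (([::], [::]) : cond A').
- exact: cond_ccc.
- split; first exact: card_le_trans (card_image_le _ _) Yc.
  by move=> h; apply: cY; exact: card_le_trans h (card_image_le _ _).
- by move=> _ [y _ <-]; exact: dense_ge.
have {}GD y : Y y -> exists2 p, G p & y \in p.2 /\ (rank y < size p.1)%N.
  by move=> Yy; have [|p [Gp Dp]] := GD (D y); [exists y|exists p].
have [n|y|t tP] := generic_localization (Y := Y) Gf.
- have [|p Gp [_ np]] := GD (f n); first exact: fY.
  by exists p => //; rewrite -(rankf n).
- by move=> /GD[p Gp []]; exists p.
by exists t => y Yy; have [n nP] := tP y Yy; exists n => k nk; exact: (nP k nk).
Qed.

Local Open Scope ring_scope.
Local Open Scope complex_scope.
Local Notation Re := complex.Re.
Local Notation Im := complex.Im.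

(** * Real-valued modulus of complex numbers *)

Section NormcTheory.
Context (R : realType).
Implicit Types z w : R[i].

Lemma normc_ge0 z : 0 <= normc z.
Proof. by case: z => a b; exact: sqrtr_ge0. Qed.

Lemma normcD z w : normc (z + w) <= normc z + normc w.
Proof. exact: (@le_normcD R). Qed.

Lemma normcNE z : normc (- z) = normc z.
Proof. exact: (@normcN R). Qed.

Lemma normc_distC z w : normc (z - w) = normc (w - z).
Proof. by rewrite -normcNE opprB. Qed.

Lemma normcB z w : normc (z - w) <= normc z + normc w.
Proof. by rewrite (le_trans (normcD _ _)) // normcNE. Qed.

Lemma normc_triangle u z w : normc (z - w) <= normc (z - u) + normc (w - u).
Proof. by rewrite (normc_distC w) (le_trans _ (normcD _ _)) // addrA subrK. Qed.

Lemma normc_dist z w : normc z - normc w <= normc (z - w).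
Proof. by rewrite lerBlDr (le_trans _ (normcD _ _)) // subrK. Qed.

Lemma normc_real (x : R) : normc x%:C = `|x|.
Proof. by rewrite /= expr0n addr0 sqrtr_sqr. Qed.

Lemma normc_gt0 z : (0 < normc z) = (z != 0).
Proof.
rewrite lt_neqAle normc_ge0 andbT eq_sym; congr (~~ _).
by apply/eqP/eqP => [/eq0_normc|->]; rewrite ?normc0.
Qed.

Lemma normc_Re z : `|Re z| <= normc z.
Proof. by case: z => a b /=; rewrite -sqrtr_sqr ler_wsqrtr // lerDl sqr_ge0. Qed.

Lemma normc_Im z : `|Im z| <= normc z.
Proof. by case: z => a b /=; rewrite -sqrtr_sqr ler_wsqrtr // lerDr sqr_ge0. Qed.

Lemma normc_le_ReIm z : normc z <= `|Re z| + `|Im z|.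
Proof.
case: z => a b /=; rewrite -[leRHS]ger0_norm ?addr_ge0 // -sqrtr_sqr.
rewrite ler_wsqrtr // sqrrD !real_normK ?num_real //.
have : 0 <= `|a| * `|b| by rewrite mulr_ge0.
by rewrite mulr2n; lra.
Qed.

Lemma normrc z : `|z| = (normc z)%:C.
Proof. by case: z => a b; rewrite normc_def. Qed.

End NormcTheory.

Arguments Normc.normc : simpl never.

(** * Sets of reals with prescribed or forbidden distances *)

Section Quaternary.
Context (R : realType).
Implicit Type S : set nat.

Definition scale m : R := 4^-1 ^+ m.

Lemma scale_gt0 m : 0 < scale m. Proof. by rewrite exprn_gt0 // invr_gt0. Qed.

Lemma scaleS m : scale m.+1 = scale m / 4.
Proof. by rewrite /scale exprSr. Qed.

Lemma scale_lt (e : R) : 0 < e -> exists n, forall m, (n <= m)%N -> scale m < e.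
Proof.
move=> e0; have e1 : 0 <= e^-1 by rewrite invr_ge0 ltW.
exists (Num.bound e^-1) => m nm.
rewrite /scale exprVn -(invrK e) ltf_pV2 ?posrE ?invr_gt0 ?exprn_gt0 //.
rewrite (lt_trans (archi_boundP e1)) // -natrX ltr_nat.
by rewrite (leq_ltn_trans nm) // ltn_expl.
Qed.

Definition qsum S n : R := \sum_(i < n | `[< S i >]) scale i.
Definition qval S : R := sup (range (qsum S)).

Lemma qsumS S n : qsum S n.+1 = qsum S n + (if `[< S n >] then scale n else 0).
Proof. by rewrite /qsum big_mkcond big_ord_recr /= -big_mkcond. Qed.

Lemma qsum_le S n m : (n <= m)%N -> qsum S n <= qsum S m.
Proof.
elim: m => [|m IH]; first by rewrite leqn0 => /eqP ->.
rewrite leq_eqVlt => /predU1P[-> //|/IH h].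
rewrite qsumS; have := scale_gt0 m; case: ifP => _; lra.
Qed.

Lemma qsum_tail S n m : qsum S n <= qsum S m + 4 / 3 * scale m.
Proof.
have [nm|/ltnW mn] := leqP n m.
  by have := qsum_le S nm; have := scale_gt0 m; lra.
(* The induction needs the exact finite geometric sum instead of the full tail [4 / 3 * scale m]. *)
suff : qsum S n <= qsum S m + 4 / 3 * (scale m - scale n).
  by have := scale_gt0 n; lra.
elim: n mn => [|n IH]; first by rewrite leqn0 => /eqP ->; lra.
rewrite leq_eqVlt => /predU1P[->|/IH]; first lra.
by rewrite qsumS scaleS; have := scale_gt0 n; case: ifP => _; lra.
Qed.

Lemma qval_ge S n : qsum S n <= qval S.
Proof.
apply: ub_le_sup; last by exists n.
by exists (qsum S 0 + 4 / 3 * scale 0) => _ [k _ <-]; exact: qsum_tail.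
Qed.

Lemma qval_le S m : qval S <= qsum S m + 4 / 3 * scale m.
Proof.
apply: ge_sup; first by exists (qsum S 0); exists 0%N.
by move=> _ [k _ <-]; exact: qsum_tail.
Qed.

(** All terms of [S'] after [m] add up to at most [scale m / 3], which cannot make up for the term
    [scale m] of [S]; this leaves the factor [2 / 3]. The factor [4 / 3] is the full geometric tail
    from [m]. *)
Lemma qval_dist_first S S' m : (forall i, (i < m)%N -> S i <-> S' i) ->
  S m -> ~ S' m -> 2 / 3 * scale m <= qval S - qval S' <= 4 / 3 * scale m.
Proof.
move=> e Sm S'm.
have em : qsum S m = qsum S' m.
  by apply: eq_bigl => i; apply/asboolP/asboolP => /(e i (ltn_ord i)).
have := qval_ge S m.+1; have := qval_le S m; have := qval_le S' m.+1.
have := qval_ge S' m; have := scale_gt0 m.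
by rewrite !qsumS scaleS em (asboolT Sm) (asboolF S'm); lra.
Qed.

(** Here [m] is the least element of the symmetric difference; the set containing it has the larger
    sum. *)
Lemma qval_dist S S' : S <> S' -> exists2 m, S m \/ S' m &
  2 / 3 * scale m <= `|qval S - qval S'| <= 4 / 3 * scale m.
Proof.
move=> SS'.
have dif : exists m, `[< S m >] != `[< S' m >].
  apply: contrapT => h; apply: SS'; apply/funext => m; apply/propext.
  apply: asbool_eq_equiv; apply/eqP; apply: contrapT => /negP hm.
  by apply: h; exists m.
have eqlt : forall i, (i < ex_minn dif)%N -> S i <-> S' i.
  case: ex_minnP => m _ hm i im.
  by apply: asbool_eq_equiv; apply/eqP; apply: contrapT => /negP/hm; rewrite leqNgt im.
move: eqlt; case: ex_minnP => m hm _ eqlt; exists m.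
  by move: hm; case: asboolP => [? _|_]; [left|case: asboolP => // ? _; right].
have := scale_gt0 m.
move: hm; case: asboolP => Sm; case: asboolP => S'm // _ s0.
  have := qval_dist_first eqlt Sm S'm => h.
  by rewrite ger0_norm //; lra.
have := @qval_dist_first S' S m (fun i im => iff_sym (eqlt i im)) S'm Sm => h.
by rewrite distrC ger0_norm //; lra.
Qed.

Lemma qval_inj : injective qval.
Proof.
move=> S S' e; apply: contrapT => /qval_dist[m _].
by rewrite e subrr normr0; have := scale_gt0 m; lra.
Qed.

End Quaternary.

(** * Rational nets that leave gaps in the set of distances *)

Section Gaps.
Context (R : realType).
Implicit Types (Y : set R[i]) (a b z : R[i]).

Definition ratc (q : rat * rat) : R[i] := ratr q.1 +i* ratr q.2.

Lemma ratc_dense z (e : R) : 0 < e -> exists q, normc (z - ratc q) < e.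
Proof.
move=> e0; have e2 : 0 < e / 2 by rewrite divr_gt0.
have [p /itvP p_] := @rat_in_itvoo R (Re z - e / 2) (Re z + e / 2) ltac:(lra).
have [q /itvP q_] := @rat_in_itvoo R (Im z - e / 2) (Im z + e / 2) ltac:(lra).
exists (p, q); apply: (le_lt_trans (normc_le_ReIm _)).
have hp : `|Re z - ratr p| < e / 2 by rewrite distrC ltr_distl !p_.
have hq : `|Im z - ratr q| < e / 2 by rewrite distrC ltr_distl !q_.
by case: z {p_ q_} hp hq => x y /= *; lra.
Qed.

Lemma seq_gap (F : seq R[i]) : exists2 d : R, 0 < d &
  {in F &, forall a b, a != b -> d <= normc (a - b)}.
Proof.
have [d d0 dP] : exists2 d : R, 0 < d &
    {in [seq (a, b) | a <- F, b <- F], forall p, p.1 != p.2 ->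
       d <= normc (p.1 - p.2)}.
  elim: [seq _ | _ <- _, _ <- _] => [|p s [d d0 IH]]; first by exists 1.
  have [e|ne] := eqVneq p.1 p.2.
    exists d => // r; rewrite inE => /predU1P[->|rs]; last exact: IH.
    by rewrite e eqxx.
  exists (Order.min d (normc (p.1 - p.2))).
    by rewrite lt_min d0 normc_gt0 subr_eq0.
  move=> r; rewrite inE => /predU1P[-> _|rs rne]; first by rewrite ge_min lexx orbT.
  by rewrite ge_min IH.
exists d => // a b aF bF ab; apply: (dP (a, b)) => //.
by apply/allpairsP; exists (a, b).
Qed.

Definition covers z k (t : nat * seq (rat * rat)) : Prop :=
  {in t.2 &, forall p q, p != q ->
     2 * k.+1%:R * scale R (k + t.1) < normc (ratc p - ratc q)} /\
  exists2 p, p \in t.2 & 4 * k.+1%:R * normc (z - ratc p) < scale R (k + t.1).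

Lemma covers_fip (F : seq R[i]) k : exists t, {in F, forall z, covers z k t}.
Proof.
have [d d0 dP] := seq_gap F.
have K1 : 1 <= k.+1%:R :> R by rewrite ler1n.
set K : R := k.+1%:R in K1.
(* With [s] the scale, net points lie within [s / (4 * K)] of points at distance at least [d]. Since
   [3 * K * s < d] and [K >= 1], they stay more than [2 * K * s] apart. *)
have [n nP] : exists n, forall m, (n <= m)%N -> scale R m < d / (3 * K).
  by apply: scale_lt; rewrite divr_gt0 // mulr_gt0 //; lra.
have {}nP := nP _ (leq_addl k n); have s0 := scale_gt0 R (k + n).
set s := scale R (k + n) in nP s0; rename nP into sd.
have {}sd : s * (3 * K) < d by rewrite -ltr_pdivlMr // mulr_gt0 //; lra.
have /choice[q qP] : forall z : R[i], exists q, 4 * K * normc (z - ratc q) < s.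
  move=> z; have [|q qP] := @ratc_dense z (s / (4 * K)).
    by rewrite divr_gt0 // mulr_gt0 //; lra.
  by exists q; rewrite mulrC -ltr_pdivlMr // mulr_gt0 //; lra.
exists (n, map q F) => z zF; split => /=; last first.
  by exists (q z); [exact: map_f|exact: qP].
move=> _ _ /mapP[a aF ->] /mapP[b bF ->] ab.
have {}ab : a != b by apply: contraNneq ab => ->.
have := dP _ _ aF bF ab.
have := qP a; have := qP b; rewrite -/s -/K => h1 h2 h3.
have := normc_triangle (ratc (q a)) a b.
have := normc_triangle (ratc (q b)) b (ratc (q a)).
have K1' : 0 <= K - 1 by lra.
have := mulr_ge0 K1' (normc_ge0 (a - ratc (q a))).
have := mulr_ge0 K1' (normc_ge0 (b - ratc (q b))).
have := mulr_ge0 K1' (ltW s0).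
lra.
Qed.

(** Two points near the same net point are closer than the sum of the two errors; points near
    distinct net points inherit the separation of the net up to these errors. *)
Lemma covers_gap a b k t : covers a k t -> covers b k t ->
  k.+1%:R * normc (a - b) < scale R (k + t.1) \/
  k.+1%:R * scale R (k + t.1) < normc (a - b).
Proof.
move=> [sep [p pt ap]] [_ [q qt bq]].
have s0 := scale_gt0 R (k + t.1).
have K1 : 0 <= k.+1%:R - 1 :> R by rewrite subr_ge0 ler1n.
move: ap bq s0 (sep _ _ pt qt) K1.
move: (scale R (k + t.1)) (k.+1%:R : R) => s K ap bq s0 {}sep K1.
have [e|pq] := eqVneq p q; [left|right].
  rewrite {}e in ap; have := normc_triangle (ratc q) a b.
  have K0 : 0 <= K by lra.
  move=> /(ler_wpM2l K0); lra.
have := sep pq; have := normc_triangle a (ratc p) (ratc q).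
have := normc_triangle b (ratc q) a.
rewrite (normc_distC (ratc q) b) (normc_distC (ratc p) a).
have := mulr_ge0 K1 (normc_ge0 (a - ratc p)).
have := mulr_ge0 K1 (normc_ge0 (b - ratc q)).
have := mulr_ge0 K1 (ltW s0).
lra.
Qed.

Lemma Martin_gaps Y : Martin_axiom -> card_lt Y continuum ->
  exists (m : nat -> nat) (Z : nat -> set R[i]),
  [/\ forall k, (k <= m k)%N,
      forall k a b, Z k a -> Z k b ->
        k.+1%:R * normc (a - b) < scale R (m k) \/
        k.+1%:R * scale R (m k) < normc (a - b)
    & forall y, Y y -> exists n, forall k, (n <= k)%N -> Z k y].
Proof.
move=> MA Yc.
have [t tP] := Martin_localization MA Yc (fun F _ => covers_fip F).
exists (fun k => k + (t k).1)%N, (fun k => [set z | covers z k (t k)]).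
split => //= [k|k a b]; [exact: leq_addr|exact: covers_gap].
Qed.

End Gaps.

(** * Derivatives and primitives in one real variable *)

(** Stated over any numeric field to serve for both [R] and [R[i]]. The increment 0, which the
    punctured limit excludes, is trivial. *)
Lemma derivable_expansion (K : numFieldType) (f : K^o -> K^o) (z : K) :
  derivable f z 1 -> forall e : K, 0 < e -> exists2 d : K, 0 < d &
  forall h, `|h| < d -> `|f (z + h) - f z - 'D_1 f z * h| <= e * `|h|.
Proof.
move=> df e e0.
have /cvgrPdist_le /(_ e e0) := df.
move=> /nbhs_ballP [d /= d0 dP]; exists d => // h hd.
have [->|h0] := eqVneq h 0.
  by rewrite addr0 mulr0 subrr subr0 !normr0 mulr0.
have := dP h; rewrite /ball /= sub0r normrN => /(_ hd h0).
have -> : lim (h^-1 *: ((f \o shift z) (h *: 1) - f z) @[h --> 0^']) = 'D_1 f z by [].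
rewrite /= [h *: 1]mulr1 [h^-1 *: _]mulrC [h + z]addrC => hle.
have -> : f (z + h) - f z - 'D_1 f z * h =
          - (('D_1 f z - (f (z + h) - f z) / h) * h).
  by rewrite mulrBl divfK // opprB.
by rewrite normrN normrM ler_wpM2r.
Qed.

Section SquareInduction.
Context (R : realType).

(* Repeated quartering of a bad square would produce bad squares shrinking to a point. *)
Lemma square_induction (P : R -> R -> R -> Prop) :
  (forall x y l, 0 < l ->
     P x y (l / 2) -> P (x + l / 2) y (l / 2) ->
     P x (y + l / 2) (l / 2) -> P (x + l / 2) (y + l / 2) (l / 2) -> P x y l) ->
  (forall a b, exists2 d, 0 < d & forall x y l, 0 < l -> l < d ->
     x <= a <= x + l -> y <= b <= y + l -> P x y l) ->
  forall x y l, 0 < l -> P x y l.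
Proof.
move=> merge local x0 y0 l0 l0_gt0; apply: contrapT => nP.
pose bad (s : R * R * R) := 0 < s.2 /\ ~ P s.1.1 s.1.2 s.2.
pose sub (s t : R * R * R) := [/\ t.2 = s.2 / 2,
  s.1.1 <= t.1.1, t.1.1 + t.2 <= s.1.1 + s.2,
  s.1.2 <= t.1.2 & t.1.2 + t.2 <= s.1.2 + s.2].
have step (s : R * R * R) : exists t, bad s -> bad t /\ sub s t.
  have [[l_gt0 nPs]|nb] := pselect (bad s); last by exists s.
  case: s l_gt0 nPs => -[x y] l /= l_gt0 nPs.
  apply: contrapT => nt; apply: nPs; apply: merge => //; apply: contrapT => nPt.
  - by apply: nt; exists (x, y, l / 2) => _; do 2?split => //=; lra.
  - by apply: nt; exists (x + l / 2, y, l / 2) => _; do 2?split => //=; lra.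
  - by apply: nt; exists (x, y + l / 2, l / 2) => _; do 2?split => //=; lra.
  - by apply: nt; exists (x + l / 2, y + l / 2, l / 2) => _; do 2?split => //=; lra.
have /choice[g gP] := step.
pose s n := iter n g (x0, y0, l0).
have s_bad n : bad (s n) by elim: n => [|n /gP[]] //.
have s_sub n : sub (s n) (s n.+1) by have [] := gP _ (s_bad n).
have s_len n : (s n).2 = l0 / 2 ^+ n.
  elim: n => [|n IH]; first by rewrite expr0 divr1.
  by have [-> _ _ _ _] := s_sub n; rewrite IH exprS invfM mulrA mulrAC.
(* Nested intervals: the supremum of the left endpoints lies in all of them. It is used for each
   coordinate of the corners. *)
have nested (u : R * R * R -> R) :
    (forall n, u (s n) <= u (s n.+1)) ->
    (forall n, u (s n.+1) + (s n.+1).2 <= u (s n) + (s n).2) ->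
    exists c, forall n, u (s n) <= c <= u (s n) + (s n).2.
  move=> u1 u2.
  have um n k : u (s n) <= u (s (n + k)%N).
    by elim: k => [|k IH]; rewrite ?addn0 // addnS (le_trans IH).
  have up n k : u (s (n + k)%N) + (s (n + k)%N).2 <= u (s n) + (s n).2.
    by elim: k => [|k IH]; rewrite ?addn0 // addnS (le_trans _ IH).
  have ub n m : u (s m) <= u (s n) + (s n).2.
    have [nm|/ltnW mn] := leqP n m.
      rewrite -(subnKC nm) (le_trans _ (up n (m - n)%N)) // lerDl ltW //.
      by have [] := s_bad (n + (m - n))%N.
    rewrite -(subnKC mn) (le_trans (um m (n - m)%N)) // lerDl ltW //.
    by have [] := s_bad (m + (n - m))%N.
  exists (sup (range (u \o s))) => n; apply/andP; split.
    by apply: ub_le_sup; [exists (u (s 0) + (s 0).2) => _ [k _ <-]; exact: ub|exists n].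
  by apply: ge_sup; [exists (u (s 0)), 0%N|move=> _ [k _ <-]; exact: ub].
have [a aP] : exists a, forall n, (s n).1.1 <= a <= (s n).1.1 + (s n).2.
  by apply: (nested (fun s => s.1.1)) => n; have [] := s_sub n.
have [b bP] : exists b, forall n, (s n).1.2 <= b <= (s n).1.2 + (s n).2.
  by apply: (nested (fun s => s.1.2)) => n; have [] := s_sub n.
have [d d0 dP] := local a b.
have [_] := s_bad (Num.bound (l0 / d)); apply; apply: dP => //.
  by have [] := s_bad (Num.bound (l0 / d)).
have ld : 0 <= l0 / d by rewrite divr_ge0 // ltW.
(* For [n] the chosen bound, [2 ^+ n > n] and [n > l0 / d], so the side has dropped below [d]. *)
rewrite s_len ltr_pdivrMr ?exprn_gt0 // mulrC -ltr_pdivrMr //.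
by rewrite (lt_trans (archi_boundP ld)) // -natrX ltr_nat ltn_expl.
Qed.

End SquareInduction.

Section RealVariable.
Context (R : realType).
Implicit Types (g : R -> R[i]) (t : R).

Definition rderiv g t (v : R[i]) := forall e : R, 0 < e -> exists2 d : R, 0 < d &
  forall s, `|s| < d -> normc (g (t + s) - g t - v * s%:C) <= e * `|s|.

Lemma rderivB g1 g2 t v1 v2 : rderiv g1 t v1 -> rderiv g2 t v2 ->
  rderiv (fun t => g1 t - g2 t) t (v1 - v2).
Proof.
move=> d1 d2 e e0; have e2 : 0 < e / 2 by rewrite divr_gt0.
have [d d0 dP] := d1 _ e2; have [d' d'0 d'P] := d2 _ e2.
exists (Order.min d d'); first by rewrite lt_min d0.
move=> s; rewrite lt_min => /andP[/dP h /d'P h'].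
rewrite (_ : _ - _ = (g1 (t + s) - g1 t - v1 * s%:C) -
                     (g2 (t + s) - g2 t - v2 * s%:C)); last by ring.
by rewrite (le_trans (normcB _ _)) //; lra.
Qed.

(** Mean value inequality, proved by bisection: square induction with the second coordinate ignored.
    Bounds on increments add up under merging, and the expansion at a point gives them locally with
    slack [e']. *)
Lemma rderiv_bound g (a b M : R) : a <= b ->
  (forall t, a <= t <= b -> exists2 v, rderiv g t v & normc v <= M) ->
  normc (g b - g a) <= M * (b - a).
Proof.
rewrite le_eqVlt => /predU1P[->|ab] gM.
  by rewrite !subrr normc0 mulr0.
apply/ler_addgt0Pr => e e0.
have ba : 0 < b - a by rewrite subr_gt0.
pose e' := e / (b - a); have e'0 : 0 < e' by rewrite divr_gt0.
pose P x (_ : R) l := a <= x -> x + l <= b ->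
  normc (g (x + l) - g x) <= (M + e') * l.
suff /(_ a 0 (b - a) ba) : forall x y l, 0 < l -> P x y l.
  rewrite /P addrC subrK !lexx => /(_ isT isT).
  by rewrite mulrDl divfK ?gt_eqF // addrC.
apply: square_induction => [x y l l0 P1 P2 _ _ ax xb|c c'].
  have := P1 ax ltac:(lra); have := P2 ltac:(lra) ltac:(lra).
  rewrite -addrA -splitr.
  have := normcD (g (x + l) - g (x + l / 2)) (g (x + l / 2) - g x).
  by rewrite addrA subrK; lra.
have [cab|ncab] := boolP (a <= c <= b); last first.
  exists 1 => // x _ l l0 _ /andP[xc cx] _ ax xb; exfalso; move: ncab.
  by rewrite (le_trans ax xc) (le_trans cx xb).
have [v dv vM] := gM _ cab.
have [d d0 dP] := dv _ e'0.
exists d => // x _ l l0 ld /andP[xc cx] _ ax xb.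
have h1 := dP (x + l - c) ltac:(by rewrite ger0_norm; lra).
have h2 := dP (x - c) ltac:(by rewrite ler0_norm; lra).
rewrite ger0_norm in h1; last lra.
rewrite ler0_norm in h2; last lra.
rewrite !(addrC c) !subrK in h1 h2.
(* Both ends are expanded at [c]; as [c] lies between them, the two errors add up to at most
   [e' * l]. *)
have -> : g (x + l) - g x = (g (x + l) - g c - v * (x + l - c)%:C) -
   (g x - g c - v * (x - c)%:C) + v * l%:C.
  by rewrite !rmorphB !rmorphD /=; ring.
have := normcD ((g (x + l) - g c - v * (x + l - c)%:C) -
   (g x - g c - v * (x - c)%:C)) (v * l%:C).
have := normcB (g (x + l) - g c - v * (x + l - c)%:C) (g x - g c - v * (x - c)%:C).
rewrite normcM normc_real (gtr0_norm l0).
have := ler_wpM2r (ltW l0) vM.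
lra.
Qed.

Lemma primitive_real (f : R -> R) : continuous f ->
  exists F : R -> R, forall t, 0 <= t -> is_derive t 1 F (f t).
Proof.
(* Integrating from [-1] makes every [t >= 0] an interior point. *)
move=> cf; exists (fun x => \int[lebesgue_measure]_(u in [set` `[-1, x]]) f u)%R.
move=> t t0.
have [||||dF F'] := @continuous_FTC1_closed R f (-1) t (t + 1).
- lra.
- apply: continuous_compact_integrable; first exact: segment_compact.
  exact: continuous_subspaceT.
- lra.
- exact: cf.
by apply: DeriveDef => //; rewrite -derive1E.
Qed.

Lemma is_derive_expansion (f : R -> R) t v : is_derive t 1 f v ->
  forall e : R, 0 < e -> exists2 d : R, 0 < d &
  forall h, `|h| < d -> `|f (t + h) - f t - v * h| <= e * `|h|.
Proof.
move=> [df <-] e e0.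
by have [d d0 dP] := derivable_expansion df e0; exists d.
Qed.

Definition rcontinuous g := forall t (e : R), 0 < e -> exists2 d : R, 0 < d &
  forall s, `|s| < d -> normc (g (t + s) - g t) <= e.

Lemma primitive g : rcontinuous g ->
  exists G, forall t, 0 <= t -> rderiv G t (g t).
Proof.
move=> cg.
have part (p : R[i] -> R) : (forall z w, p (z - w) = p z - p w) ->
    (forall z, `|p z| <= normc z) -> continuous (p \o g).
  move=> pB pn t; apply/cvgrPdist_le => e e0.
  have [d d0 dP] := cg t e e0.
  apply/nbhs_ballP; exists d => //= s; rewrite /ball /= distrC => sd.
  rewrite distrC -pB (le_trans (pn _)) //.
  by have := dP _ sd; rewrite (addrC t) subrK.
have [A dA] := primitive_real
  (part (@complex.Re R) (fun '(_ +i* _) '(_ +i* _) => erefl) (@normc_Re R)).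
have [B dB] := primitive_real
  (part (@complex.Im R) (fun '(_ +i* _) '(_ +i* _) => erefl) (@normc_Im R)).
exists (fun t => A t +i* B t) => t t0 e e0.
have e2 : 0 < e / 2 by rewrite divr_gt0.
have [d d0 dP] := is_derive_expansion (dA t t0) e2.
have [d' d'0 d'P] := is_derive_expansion (dB t t0) e2.
exists (Order.min d d'); first by rewrite lt_min d0.
move=> s; rewrite lt_min => /andP[/dP h /d'P h'].
apply: (le_trans (normc_le_ReIm _)); move: h h' => /=; case: (g t) => x y /=.
by rewrite !mulr0 add0r subr0; lra.
Qed.

End RealVariable.

(** * Goursat's lemma and the Cauchy estimate *)

Section ComplexDerivative.
Context (R : realType).
Implicit Types (f g : R[i] -> R[i]) (z v w h : R[i]) (e d : R).

Definition cderiv f z v := forall e, 0 < e -> exists2 d, 0 < d &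
  forall h, normc h < d -> normc (f (z + h) - f z - v * h) <= e * normc h.

Lemma entire_cderiv f : entire f -> exists f', forall z, cderiv f z (f' z).
Proof.
move=> df; exists (fun z => 'D_1 (f : R[i]^o -> R[i]^o) z) => z e e0.
have eC0 : 0 < e%:C by rewrite (ltcR 0).
have [d d0 dP] := derivable_expansion (df z) eC0.
(* A positive element of [R[i]] is real, so the radius can be taken in [R]. *)
have dE : d = (Re d)%:C by case: d d0 {dP} => x y; rewrite ltcE /= => /andP[/eqP -> _].
exists (Re d); first by move: d0; rewrite dE (ltcR 0).
move=> h hd; have := dP h; rewrite dE !normrc ltcR => /(_ hd).
by rewrite -rmorphM lecR.
Qed.

Lemma cderiv_continuous f z v : cderiv f z v -> forall e, 0 < e ->
  exists2 d, 0 < d & forall h, normc h < d -> normc (f (z + h) - f z) <= e.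
Proof.
move=> df e e0; have [d d0 dP] := df 1 ltr01.
have v0 := normc_ge0 v.
exists (Order.min d (e / (normc v + 1))).
  by rewrite lt_min d0 divr_gt0 //; lra.
move=> h; rewrite lt_min => /andP[/dP hd]; rewrite ltr_pdivlMr; last lra.
have := normcD (f (z + h) - f z - v * h) (v * h).
by rewrite subrK normcM; lra.
Qed.

Lemma cderivB f g z v w : cderiv f z v -> cderiv g z w ->
  cderiv (fun z => f z - g z) z (v - w).
Proof.
move=> df dg e e0; have e2 : 0 < e / 2 by rewrite divr_gt0.
have [d d0 dP] := df _ e2; have [d' d'0 d'P] := dg _ e2.
exists (Order.min d d'); first by rewrite lt_min d0.
move=> h; rewrite lt_min => /andP[/dP h1 /d'P h2].
rewrite (_ : _ - _ = (f (z + h) - f z - v * h) - (g (z + h) - g z - w * h));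
  last by ring.
by rewrite (le_trans (normcB _ _)) //; lra.
Qed.

Lemma cderivM f g z v w : cderiv f z v -> cderiv g z w ->
  cderiv (fun z => f z * g z) z (v * g z + f z * w).
Proof.
move=> df dg e e0.
have [[f0 g0] v0] := (normc_ge0 (f z), normc_ge0 (g z), normc_ge0 v).
(* The three error terms below are at most [e / C * normc h] times [normc (g z) + 1], [normc v] and
   [normc (f z)]; these factors sum to [C]. *)
pose C := normc (g z) + normc v + normc (f z) + 1.
have C0 : 0 < C by rewrite /C; lra.
have e1 : 0 < e / C by rewrite divr_gt0.
have m0 : 0 < Order.min 1 (e / C) by rewrite lt_min ltr01.
have [d1 d10 dP1] := df _ e1; have [d2 d20 dP2] := dg _ e1.
have [d3 d30 dP3] := cderiv_continuous dg m0.
exists (Order.min d1 (Order.min d2 d3)); first by rewrite !lt_min d10 d20.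
move=> h; rewrite !lt_min => /and3P[/dP1 h1 /dP2 h2 /dP3 h34].
move: h34; rewrite le_min => /andP[h3 h4].
have eE : e = e / C * C by rewrite divfK // gt_eqF.
have -> : f (z + h) * g (z + h) - f z * g z - (v * g z + f z * w) * h =
  (f (z + h) - f z - v * h) * (g z + (g (z + h) - g z)) +
  v * h * (g (z + h) - g z) + f z * (g (z + h) - g z - w * h) by ring.
set F := f (z + h) - f z - v * h in h1 *.
set G := g (z + h) - g z in h3 h4 h2 *.
set H := G - w * h in h2 *.
have n0 := normc_ge0 h.
have := normcD (F * (g z + G) + v * h * G) (f z * H).
have := normcD (F * (g z + G)) (v * h * G).
rewrite !normcM.
have : normc F * normc (g z + G) <= e / C * normc h * (normc (g z) + 1).
  by apply: ler_pM => //; rewrite ?normc_ge0 // (le_trans (normcD _ _)) // lerD2l.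
have : normc v * normc h * normc G <= normc v * normc h * (e / C).
  by apply: ler_wpM2l => //; rewrite mulr_ge0.
have : normc (f z) * normc H <= normc (f z) * (e / C * normc h).
  exact: ler_wpM2l.
have : e * normc h = e / C * normc h * (normc (g z) + 1) +
  normc v * normc h * (e / C) + normc (f z) * (e / C * normc h).
  by rewrite {1}eE /C; ring.
by lra.
Qed.

Lemma cderiv_comp f g z v w : cderiv g z w -> cderiv f (g z) v ->
  cderiv (f \o g) z (v * w).
Proof.
move=> dg df e e0.
have [v0 w0] := (normc_ge0 v, normc_ge0 w).
(* Half of [e] pays for the error of [f], as the increment of [g] is at most
   [(normc w + 1) * normc h]; the other half pays for [v] times the error of [g]. *)
pose e2 := e / 2 / (normc w + 1).
have e20 : 0 < e2 by rewrite !divr_gt0 //; lra.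
pose e1 := Order.min 1 (e / 2 / (normc v + 1)).
have e10 : 0 < e1 by rewrite lt_min ltr01 !divr_gt0 //; lra.
have [d2 d20 dP2] := df _ e20.
have [d1 d10 dP1] := dg _ e10.
(* Halved because continuity yields only a weak inequality. *)
have d2' : 0 < d2 / 2 by rewrite divr_gt0.
have [d3 d30 dP3] := cderiv_continuous dg d2'.
exists (Order.min d1 d3); first by rewrite lt_min d10.
move=> h; rewrite lt_min => /andP[/dP1 h1 /dP3 h3].
have := dP2 (g (z + h) - g z); rewrite (addrC (g z)) subrK => /(_ ltac:(lra)) h2.
rewrite /= (_ : _ - _ = (f (g (z + h)) - f (g z) - v * (g (z + h) - g z)) +
  v * (g (z + h) - g z - w * h)); last by ring.
have n0 := normc_ge0 h.
have h4 := normcD (g (z + h) - g z - w * h) (w * h).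
rewrite subrK normcM in h4.
set G := g (z + h) - g z in h1 h2 h3 h4 *.
rewrite (le_trans (normcD _ _)) // normcM.
have h5 : normc G <= (normc w + 1) * normc h.
  have : e1 * normc h <= 1 * normc h by rewrite ler_wpM2r // ge_min lexx.
  lra.
have h6 := ler_wpM2l (ltW e20) h5.
have h7 : e1 * normc h <= e / 2 / (normc v + 1) * normc h.
  by rewrite ler_wpM2r // ge_min lexx orbT.
have h8 := ler_wpM2l v0 (le_trans h1 h7).
have h9 : e2 * ((normc w + 1) * normc h) = e / 2 * normc h.
  by rewrite mulrA divfK //; lra.
have h10 : normc v * (e / 2 / (normc v + 1) * normc h) <= e / 2 * normc h.
  rewrite mulrA ler_wpM2r // mulrCA ler_piMr ?divr_ge0 //; first lra.
  by rewrite ler_pdivrMr; lra.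
lra.
Qed.

(** Provides the primitive of an affine approximation that is subtracted in [Goursat]. *)
Lemma cderiv_quadratic (b c z0 z : R[i]) :
  cderiv (fun z => b * (z - z0) + c * (z - z0) ^+ 2) z (b + 2 * c * (z - z0)).
Proof.
move=> e e0; have c0 := normc_ge0 c.
exists (e / (normc c + 1)); first by rewrite divr_gt0 //; lra.
move=> h; rewrite ltr_pdivlMr; last lra.
move=> he; rewrite (_ : _ - _ = c * h * h); last by ring.
have n0 := normc_ge0 h; rewrite !normcM ler_wpM2r //; lra.
Qed.

Lemma cderiv_affine (b c z : R[i]) : cderiv (fun z => b + c * z) z c.
Proof.
move=> e e0; exists 1 => // h _.
rewrite (_ : _ - _ = 0); last by ring.
by rewrite normc0 mulr_ge0 ?normc_ge0 // ltW.
Qed.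

Lemma cderiv_cst (b z : R[i]) : cderiv (fun=> b) z 0.
Proof.
move=> e e0; exists 1 => // h _.
by rewrite subrr mul0r subr0 normc0 mulr_ge0 ?normc_ge0 // ltW.
Qed.

Lemma cderiv_translation (b z : R[i]) : cderiv (fun z => b + z) z 1.
Proof.
move=> e e0; exists 1 => // h _.
by rewrite (_ : _ - _ = 0) ?normc0 ?mulr_ge0 ?normc_ge0 ?ltW //; ring.
Qed.

Lemma cderiv_line f (p w : R[i]) (t : R) v : cderiv f (p + w * t%:C) v ->
  rderiv (fun t => f (p + w * t%:C)) t (v * w).
Proof.
move=> df e e0; have w0 := normc_ge0 w.
have e1 : 0 < e / (normc w + 1) by rewrite divr_gt0 //; lra.
have [d d0 dP] := df _ e1.
exists (d / (normc w + 1)); first by rewrite divr_gt0 //; lra.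
move=> s; rewrite ltr_pdivlMr; last lra.
move=> sd; have s0 := normr_ge0 s.
have := dP (w * s%:C); rewrite normcM normc_real => /(_ ltac:(lra)).
rewrite rmorphD /= mulrDr addrA mulrA => h; apply: (le_trans h).
rewrite mulrA ler_wpM2r // mulrAC ler_pdivrMr; nra.
Qed.

End ComplexDerivative.

(** * The complex exponential *)

Section ComplexExp.
Context (R : realType).
Implicit Types z w h : R[i].

Definition cexp z : R[i] :=
  (expR (Re z) * cos (Im z)) +i* (expR (Re z) * sin (Im z)).

Lemma cexpD z w : cexp (z + w) = cexp z * cexp w.
Proof.
case: z w => a b [c d]; rewrite /cexp /= expRD cosD sinD.
by congr Complex; ring.
Qed.

Lemma cexp0 : cexp 0 = 1.
Proof. by rewrite /cexp /= expR0 cos0 sin0 mulr0 mulr1. Qed.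

Lemma cexpN z : cexp (- z) * cexp z = 1.
Proof. by rewrite -cexpD addNr cexp0. Qed.

Lemma normc_cexp z : normc (cexp z) = expR (Re z).
Proof.
rewrite /cexp /normc !exprMn -mulrDr cos2Dsin2 mulr1 sqrtr_sqr ger0_norm //.
exact: expR_ge0.
Qed.

Lemma cexp_periodic z : cexp (z + 0 +i* (pi *+ 2)) = cexp z.
Proof.
rewrite cexpD {2}/cexp /= expR0 cos2pi sin2pi mulr0 mulr1.
by rewrite [X in _ * X](_ : _ = 1) ?mulr1.
Qed.

Lemma cderiv_cexp z : cderiv cexp z (cexp z).
Proof.
(* By the functional equation, the expansion at [z] is the one at 0 multiplied by [cexp z]. *)
suff d0 : cderiv cexp 0 1.
  move=> e e0; have m0 : 0 < expR (Re z) by exact: expR_gt0.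
  have e1 : 0 < e / expR (Re z) by rewrite divr_gt0.
  have [d d_gt0 dP] := d0 _ e1; exists d => // h /dP.
  rewrite add0r cexp0 mul1r cexpD => hle.
  rewrite (_ : _ - _ = cexp z * (cexp h - 1 - h)); last by ring.
  rewrite normcM normc_cexp; apply: (le_trans (ler_wpM2l (ltW m0) hle)).
  by rewrite mulrA (mulrC (expR _)) divfK // gt_eqF.
move=> e e0.
(* The real part contributes an error of [4 * e1 * n] and the imaginary part [5 * e1 * n], with [n]
   the modulus of [h]; hence the 9. The bound [e1 <= 1] keeps the exponential factor at most 3. *)
have [e1 e10 [e11 e19]] : exists2 e1 : R, 0 < e1 & e1 <= 1 /\ e1 <= e / 9.
  exists (Order.min 1 (e / 9)); first by rewrite lt_min ltr01 divr_gt0.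
  by rewrite !ge_min !lexx orbT.
have [d1 d10 dP1] := is_derive_expansion (is_derive_expR (0 : R)) e10.
have [d2 d20 dP2] := is_derive_expansion (is_derive_cos (0 : R)) e10.
have [d3 d30 dP3] := is_derive_expansion (is_derive_sin (0 : R)) e10.
exists (Order.min e1 (Order.min d1 (Order.min d2 d3))).
  by rewrite !lt_min e10 d10 d20.
move=> h; rewrite !lt_min => /and4P[he h1 h2 h3].
have ha := normc_Re h; have hb := normc_Im h.
have {dP1} := dP1 _ (le_lt_trans ha h1).
have {dP2} := dP2 _ (le_lt_trans hb h2).
have {dP3} := dP3 _ (le_lt_trans hb h3).
rewrite !add0r cexp0 mul1r expR0 cos0 sin0 oppr0 mul0r !mul1r !subr0.
have := normc_le_ReIm (cexp h - 1 - h).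
rewrite /cexp; case: h {h1 h2 h3} ha hb he => a b.
set n := normc _; rewrite /= => ha hb he.
have n0 : 0 <= n by exact: normc_ge0.
move: (expR a) (cos b) (sin b) => A C S hle; rewrite addr0 => hS hC hA.
have e1n : e1 * n <= e / 9 * n by rewrite ler_wpM2r.
have e1a : e1 * `|a| <= e1 * n by rewrite ler_wpM2l // ltW.
have e1b : e1 * `|b| <= e1 * n by rewrite ler_wpM2l // ltW.
have e1n' : e1 * n <= 1 * n by rewrite ler_wpM2r.
have A2 : `|A - 1| <= 2 * n.
  have : `|A - 1| <= `|A - 1 - a| + `|a| 
    by have := ler_normD (A - 1 - a) a; rewrite subrK.
  lra.
have A3 : `|A| <= 3.
  have : `|A| <= `|A - 1| + 1 
    by have := ler_normD (A - 1) 1; rewrite subrK normr1.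
  lra.
have S2 : `|S| <= 2 * n.
  have : `|S| <= `|S - b| + `|b| 
    by have := ler_normD (S - b) b; rewrite subrK.
  lra.
have hC' : `|C - 1| <= e1 * n by lra.
have p1 : `|A| * `|C - 1| <= 3 * (e1 * n) by rewrite ler_pM.
have p2 : `|A - 1| * `|S| <= 2 * n * (2 * n) by rewrite ler_pM.
have p3 : n * n <= e1 * n by rewrite ler_wpM2r // ltW.
apply: (le_trans hle).
have : `|A * C - 1 - a| <= e1 * n + 3 * (e1 * n).
  rewrite (_ : _ - a = (A - 1 - a) + A * (C - 1)); last by ring.
  by rewrite (le_trans (ler_normD _ _)) // normrM; lra.
have : `|A * S - 0 - b| <= e1 * n + 2 * n * (2 * n).
  rewrite (_ : _ - b = (S - b) + (A - 1) * S); last by ring.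
  by rewrite (le_trans (ler_normD _ _)) // normrM; lra.
lra.
Qed.

End ComplexExp.

(** * Contour sums around squares and Goursat's lemma *)

Section Goursat.
Context (R : realType).
Implicit Types (x y l t e : R) (z v : R[i]).

Definition iC : R[i] := 0 +i* 1.

Lemma normc_iC : normc iC = 1.
Proof. by rewrite /iC /normc expr0n expr1n add0r sqrtr1. Qed.

Lemma horizontalE t y : t +i* y = (0 +i* y) + 1 * t%:C.
Proof. by rewrite mul1r; congr Complex; rewrite /= ?add0r ?addr0. Qed.

Lemma verticalE x t : x +i* t = x%:C + iC * t%:C.
Proof. by congr Complex; rewrite /=; ring. Qed.

Lemma rderiv_horizontal (f : R[i] -> R[i]) t y v : cderiv f (t +i* y) v ->
  rderiv (fun t => f (t +i* y)) t v.
Proof.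
rewrite horizontalE => /cderiv_line; rewrite mulr1.
by under [X in _ -> rderiv X _ _]eq_fun do rewrite horizontalE.
Qed.

Lemma rderiv_vertical (f : R[i] -> R[i]) x t v : cderiv f (x +i* t) v ->
  rderiv (fun t => f (x +i* t)) t (v * iC).
Proof.
rewrite verticalE => /cderiv_line.
by under [X in _ -> rderiv X _ _]eq_fun do rewrite verticalE.
Qed.

(** Choosing the primitive as a function of the integrand gives equal integrands equal primitives.
    Hence sides shared by neighbouring squares cancel, and so do horizontal sides one period
    apart. *)
Lemma primitive_operator : exists pr : (R -> R[i]) -> R -> R[i], forall g,
  rcontinuous g ->
  forall t, 0 <= t -> rderiv (pr g) t (g t).
Proof.
have /choice[pr prP] : forall g : R -> R[i], exists G,
    rcontinuous g -> forall t, 0 <= t -> rderiv G t (g t).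
  move=> g; have [cg|ncg] := pselect (rcontinuous g).
    by have [G GP] := primitive cg; exists G.
  by exists g => /ncg.
by exists pr.
Qed.

Context (G G' : R[i] -> R[i]) (dG : forall z, cderiv G z (G' z)).
Context (pr : (R -> R[i]) -> R -> R[i]).
Context (prP : forall g,
  rcontinuous g ->
  forall t, 0 <= t -> rderiv (pr g) t (g t)).

Definition horizontal y t := G (t +i* y).
Definition vertical x t := G (x +i* t) * iC.

Lemma pr_horizontal y t : 0 <= t -> rderiv (pr (horizontal y)) t (horizontal y t).
Proof.
move: t; apply: prP => t e e0.
have [d d0 dP] := cderiv_continuous (dG (t +i* y)) e0.
exists d => // s sd; have := dP s%:C; rewrite normc_real => /(_ sd).
rewrite /horizontal (_ : (t + s) +i* y = t +i* y + s%:C) //.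
by congr Complex; rewrite addr0.
Qed.

Lemma pr_vertical x t : 0 <= t -> rderiv (pr (vertical x)) t (vertical x t).
Proof.
move: t; apply: prP => t e e0.
have [d d0 dP] := cderiv_continuous (dG (x +i* t)) e0.
exists d => // s sd; have := dP (iC * s%:C).
rewrite normcM normc_iC mul1r normc_real => /(_ sd).
rewrite /vertical -mulrBl normcM normc_iC mulr1.
by rewrite (_ : x +i* (t + s) = x +i* t + iC * s%:C) //; congr Complex; rewrite /=; ring.
Qed.

(** The counterclockwise integral of [G] around the square with lower left corner [x +i* y] and side
    [l], as increments of primitives; the factor [iC] in [vertical] is the derivative of the
    path. *)
Definition contour x y l : R[i] :=
  (pr (horizontal y) (x + l) - pr (horizontal y) x) +
  (pr (vertical (x + l)) (y + l) - pr (vertical (x + l)) y) -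
  (pr (horizontal (y + l)) (x + l) - pr (horizontal (y + l)) x) -
  (pr (vertical x) (y + l) - pr (vertical x) y).

(* Subtracting an exact form dF changes nothing, as F telescopes around the square. *)
Lemma contour_bound (F F' : R[i] -> R[i]) (M : R) x y l :
  (forall z, cderiv F z (F' z)) -> 0 <= x -> 0 <= y -> 0 < l ->
  (forall t u, x <= t <= x + l -> y <= u <= y + l ->
     normc (G (t +i* u) - F' (t +i* u)) <= M) ->
  normc (contour x y l) <= 4 * M * l.
Proof.
move=> dF x0 y0 l0 bM.
have side_h u : y <= u <= y + l ->
    normc ((pr (horizontal u) (x + l) - F ((x + l) +i* u)) -
           (pr (horizontal u) x - F (x +i* u))) <= M * l.
  move=> yu; rewrite -[X in M * X](addrK x) (addrC l).
  apply: (@rderiv_bound _ (fun t => pr (horizontal u) t - F (t +i* u))); first lra.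
  move=> t xt; exists (horizontal u t - F' (t +i* u)); last exact: bM.
  apply: rderivB; first by apply: pr_horizontal; lra.
  exact: rderiv_horizontal.
have side_v t : x <= t <= x + l ->
    normc ((pr (vertical t) (y + l) - F (t +i* (y + l))) -
           (pr (vertical t) y - F (t +i* y))) <= M * l.
  move=> xt; rewrite -[X in M * X](addrK y) (addrC l).
  apply: (@rderiv_bound _ (fun u => pr (vertical t) u - F (t +i* u))); first lra.
  move=> u yu; exists (vertical t u - F' (t +i* u) * iC); last first.
    by rewrite -mulrBl normcM normc_iC mulr1; exact: bM.
  apply: rderivB; first by apply: pr_vertical; lra.
  exact: rderiv_vertical.
have := side_h y ltac:(lra); have := side_h (y + l) ltac:(lra).
have := side_v x ltac:(lra); have := side_v (x + l) ltac:(lra).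
set s1 := (_ - _ : R[i]); set s2 := (_ - _ : R[i]).
set s3 := (_ - _ : R[i]); set s4 := (_ - _ : R[i]).
have -> : contour x y l = (s4 + s1) - (s3 + s2).
  by rewrite /contour /s1 /s2 /s3 /s4; ring.
have := normcB (s4 + s1) (s3 + s2); have := normcD s4 s1; have := normcD s3 s2.
lra.
Qed.

(** The inner sides of the four quarters are traversed twice in opposite directions and cancel. *)
Lemma contour_split x y l : contour x y l =
  contour x y (l / 2) + contour (x + l / 2) y (l / 2) +
  contour x (y + l / 2) (l / 2) + contour (x + l / 2) (y + l / 2) (l / 2).
Proof. by rewrite /contour -!addrA -!splitr !addrA; ring. Qed.

(** Square induction on the bound [e * l ^+ 2], which is additive over the four quarters. Locally
    [G] is close to an affine function, which has a primitive. *)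
Lemma Goursat x y l : 0 <= x -> 0 <= y -> 0 < l -> contour x y l = 0.
Proof.
move=> x0 y0 l0; apply: eq0_normc; apply/eqP; rewrite eq_le normc_ge0 andbT.
apply/ler_addgt0Pl => e' e'0; rewrite addr0.
have e0 : 0 < e' / l ^+ 2 by rewrite divr_gt0 // exprn_gt0.
rewrite -(@divfK _ (l ^+ 2) _ e') ?gt_eqF ?exprn_gt0 //.
move: (e' / l ^+ 2) e0 => e e0 {e' e'0}.
pose P x y l := 0 <= x -> 0 <= y -> normc (contour x y l) <= e * l ^+ 2.
suff : P x y l by apply.
move: x y l l0 {x0 y0}; apply: square_induction => [x y l l0 P1 P2 P3 P4 x0 y0|a b].
  have := P1 x0 y0; have := P2 ltac:(lra) y0; have := P3 x0 ltac:(lra).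
  have := P4 ltac:(lra) ltac:(lra).
  rewrite [contour x y l]contour_split.
  set c1 := contour x y _; set c2 := contour (x + l / 2) y _.
  set c3 := contour x _ _; set c4 := contour (x + l / 2) _ _.
  have := normcD (c1 + c2 + c3) c4; have := normcD (c1 + c2) c3.
  have := normcD c1 c2; rewrite expr_div_n; lra.
(* Points of the square are within [2 * l] of [z0] and the perimeter is [4 * l], so an error rate of
   [e / 8] yields [e * l ^+ 2]. *)
have e8 : 0 < e / 8 by rewrite divr_gt0.
have [d d0 dP] := dG (a +i* b) e8.
exists (d / 2) => [|x y l l0 ld xa yb x0 y0]; first by rewrite divr_gt0.
set z0 := a +i* b in dP.
have := @contour_bound _ _ (e / 8 * (2 * l)) x y l
  (cderiv_quadratic (G z0) (G' z0 / 2) z0) x0 y0 l0.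
rewrite (_ : 4 * _ * l = e * l ^+ 2); last by field.
apply=> t u xt yu.
have hz : normc (t +i* u - z0) <= 2 * l.
  apply: (le_trans (normc_le_ReIm _)) => /=.
  have : `|t - a| <= l by rewrite ler_distl; lra.
  have : `|u - b| <= l by rewrite ler_distl; lra.
  lra.
have := dP (t +i* u - z0) ltac:(lra).
rewrite (addrC z0) subrK => h.
rewrite (_ : _ - _ = G (t +i* u) - G z0 - G' z0 * (t +i* u - z0)); last by field.
by rewrite (le_trans h) // ler_wpM2l // ltW.
Qed.

(** [Goursat] on a square whose side is one period: the horizontal sides cancel, so the vertical
    ones agree. Chaining such squares reaches all multiples of the period. *)
Lemma vertical_periodic : (forall z, G (z + 0 +i* (pi *+ 2)) = G z) ->
  forall n, pr (vertical (pi *+ 2 *+ n)) (pi *+ 2) - pr (vertical (pi *+ 2 *+ n)) 0 =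
            pr (vertical 0) (pi *+ 2) - pr (vertical 0) 0.
Proof.
move=> Gper; elim=> [//|n <-].
have p0 : 0 < pi *+ 2 :> R by rewrite pmulrn_lgt0 // pi_gt0.
have := Goursat (mulrn_wge0 n (ltW p0)) (lexx 0) p0.
rewrite /contour add0r -mulrSr.
have -> : horizontal (pi *+ 2) = horizontal 0.
  apply/funext => t; rewrite /horizontal -[RHS]Gper.
  by congr G; congr Complex; rewrite ?addr0 ?add0r.
set h := (pr (horizontal 0) _ - _); set v1 := (pr _ _ - _); set v0 := (pr _ _ - _).
by rewrite (_ : _ - _ - _ = v1 - v0) ?subr0; [move/eqP; rewrite subr_eq0 => /eqP|ring].
Qed.

(** The integral over one vertical period is bounded through [M] at abscissa 0. It is the same far
    to the right, where it is close to [v] times [iC] times the period. *)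
Lemma periodic_limit_bound v (M : R) :
  (forall z, G (z + 0 +i* (pi *+ 2)) = G z) ->
  (forall e, 0 < e -> exists X, forall x t, X <= x -> normc (G (x +i* t) - v) <= e) ->
  (forall t, normc (G (0 +i* t)) <= M) -> normc v <= M.
Proof.
move=> Gper Glim GM; apply/ler_addgt0Pr => e e0.
have p0 : 0 < pi *+ 2 :> R by rewrite pmulrn_lgt0 // pi_gt0.
have [X XP] := Glim _ e0.
pose n := Num.bound (`|X| / (pi *+ 2)).
have Xn : X <= pi *+ 2 *+ n.
  rewrite (le_trans (ler_norm _)) // -mulr_natl -ler_pdivrMr // ltW //.
  by apply: archi_boundP; rewrite divr_ge0 // ltW.
have J0 : normc (pr (vertical 0) (pi *+ 2) - pr (vertical 0) 0) <= M * (pi *+ 2 - 0).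
  apply: rderiv_bound => [|t /andP[t0 _]]; first exact: ltW.
  exists (vertical 0 t); first exact: pr_vertical.
  by rewrite normcM normc_iC mulr1.
have := vertical_periodic Gper n; set x := pi *+ 2 *+ n in Xn * => Jx.
(* Compares the integrand with the constant [v], whose primitive is [v * z]. *)
have : normc ((pr (vertical x) (pi *+ 2) - v * (x +i* (pi *+ 2))) -
              (pr (vertical x) 0 - v * (x +i* 0))) <= e * (pi *+ 2 - 0).
  apply: (@rderiv_bound _ (fun t => pr (vertical x) t - v * (x +i* t))).
    exact: ltW.
  move=> t /andP[t0 _].
  exists (vertical x t - v * iC); last by rewrite -mulrBl normcM normc_iC mulr1 XP.
  apply: rderivB; first exact: pr_vertical.
  apply: (@rderiv_vertical (fun z => v * z)).
  have := @cderiv_affine R 0 v (x +i* t).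
  by under [X in cderiv X _ _ -> _]eq_fun do rewrite add0r.
have -> : (pr (vertical x) (pi *+ 2) - v * (x +i* (pi *+ 2))) -
          (pr (vertical x) 0 - v * (x +i* 0)) =
   (pr (vertical 0) (pi *+ 2) - pr (vertical 0) 0) - v * (iC * (pi *+ 2)%:C).
  rewrite -Jx (verticalE x (pi *+ 2)) (verticalE x 0) rmorph0; ring.
rewrite subr0 in J0; rewrite subr0 normc_distC.
set j := pr _ _ - pr _ _ in J0 *.
have := normc_dist (v * (iC * (pi *+ 2)%:C)) j.
rewrite !normcM normc_iC mul1r normc_real gtr0_norm // => h' h.
by rewrite -(ler_pM2r p0); lra.
Qed.

End Goursat.

(** * The Cauchy estimate and density of critical points *)

Section CauchyEstimate.
Context (R : realType).
Implicit Types (f : R[i] -> R[i]) (a b z u h : R[i]).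

(* The mean over t of (f(a + r e^it) - f(a)) e^-it / r does not depend on r and tends to
   f'(a) as r -> 0: Goursat is applied in the coordinate z with r e^it = e^-z. *)
Lemma Cauchy_estimate f f' a (M : R) : (forall z, cderiv f z (f' z)) ->
  (forall u, normc u = 1 -> normc (f (a + u) - f a) <= M) -> normc (f' a) <= M.
Proof.
move=> df fM.
(* The line [Re z = 0] is sent to the unit circle, and [a + E z] tends to [a] as [Re z] grows. *)
pose E z := cexp (- z); pose G z := (f (a + E z) - f a) * cexp z.
have dE z : cderiv E z (cexp (- z) * -1).
  apply: cderiv_comp (cderiv_cexp _).
  have := @cderiv_affine R 0 (-1) z.
  by under [X in cderiv X _ _ -> _]eq_fun do rewrite add0r mulN1r.
have /choice[G' dG] : forall z, exists v, cderiv G z v.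
  move=> z; eexists; apply: cderivM (cderiv_cexp _).
  apply: cderivB (cderiv_cst _ _).
  apply: (@cderiv_comp _ (fun z => f (a + z)) E) (dE z) _.
  apply: (@cderiv_comp _ f (fun z => a + z)) (df _).
  exact: cderiv_translation.
have [pr prP] := primitive_operator R.
apply: (periodic_limit_bound dG prP) => [z|e e0|t].
- rewrite /G /E opprD cexp_periodic.
  by rewrite -(cexp_periodic (- z + _)) -addrA addNr addr0.
- have [d d0 dP] := df a _ e0.
  exists (- ln d + 1) => x t xd.
  have hd : normc (E (x +i* t)) < d.
    rewrite /E normc_cexp /= -[ltRHS]lnK ?posrE // ltr_expR; lra.
  have := dP _ hd; set w := E _ => h.
  have wn0 : normc w != 0 by rewrite normc_cexp gt_eqF ?expR_gt0.
  have wE : cexp (x +i* t) * w = 1 by rewrite mulrC cexpN.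
  rewrite (_ : _ - _ = (f (a + w) - f a - f' a * w) * cexp (x +i* t)); last first.
    by rewrite [RHS]mulrBl -mulrA (mulrC w) wE mulr1.
  rewrite normcM; have := ler_wpM2r (normc_ge0 (cexp (x +i* t))) h.
  by rewrite -mulrA -!normcM (mulrC w) wE normc1 mulr1.
- rewrite /G normcM normc_cexp /= expR0 mulr1; apply: fM.
  by rewrite normc_cexp /= oppr0 expR0.
Qed.

(** Compactness by square induction: the moduli of the four quarters combine by a minimum, and near
    a point both values are compared with the value there. *)
Lemma uniform_continuity_square f (x y l e : R) : 0 < l -> 0 < e ->
  (forall z (e : R), 0 < e -> exists2 d : R, 0 < d &
     forall h, normc h < d -> normc (f (z + h) - f z) <= e) ->
  exists2 d : R, 0 < d & forall (t u : R) h, x <= t <= x + l -> y <= u <= y + l ->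
    normc h < d -> normc (f ((t +i* u) + h) - f (t +i* u)) <= e.
Proof.
move=> l0 e0 cf.
pose P (x y l : R) := exists2 d : R, 0 < d & forall (t u : R) h,
  x <= t <= x + l -> y <= u <= y + l ->
    normc h < d -> normc (f ((t +i* u) + h) - f (t +i* u)) <= e.
suff : P x y l by [].
move: x y l l0; apply: square_induction => [x y l l0|a b].
  move=> [d1 d10 P1] [d2 d20 P2] [d3 d30 P3] [d4 d40 P4].
  exists (Order.min (Order.min d1 d2) (Order.min d3 d4)).
    by rewrite !lt_min d10 d20 d30.
  move=> t u h xt yu; rewrite !lt_min => /andP[/andP[h1 h2] /andP[h3 h4]].
  have [tx|/ltW tx] := leP t (x + l / 2); have [ty|/ltW ty] := leP u (y + l / 2).
  - by apply: P1 => //; lra.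
  - by apply: P3 => //; lra.
  - by apply: P2 => //; lra.
  - by apply: P4 => //; lra.
have e2 : 0 < e / 2 by rewrite divr_gt0.
have [d d0 dP] := cf (a +i* b) _ e2.
(* The point is within [2 * l < d / 2] of the centre, and adding [h] still leaves it within [d]. *)
exists (d / 4) => [|x y l l0 ld xa yb]; first by rewrite divr_gt0.
exists (d / 4) => [|t u h xt yu hd]; first by rewrite divr_gt0.
have hz : normc (t +i* u - a +i* b) <= 2 * l.
  apply: (le_trans (normc_le_ReIm _)) => /=.
  have : `|t - a| <= l by rewrite ler_distl; lra.
  have : `|u - b| <= l by rewrite ler_distl; lra.
  lra.
have := dP (t +i* u - a +i* b) ltac:(lra).
have := dP (t +i* u - a +i* b + h).
have := normcD (t +i* u - a +i* b) h.
rewrite addrA (addrC (a +i* b)) subrK => h1 h2 h3.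
have {}h2 := h2 ltac:(lra).
rewrite (_ : _ - _ = (f (t +i* u + h) - f (a +i* b)) - (f (t +i* u) - f (a +i* b)));
  last by ring.
by rewrite (le_trans (normcB _ _)) //; lra.
Qed.

Lemma entire_dense_critical f f' : (forall z, cderiv f z (f' z)) ->
  (forall z (e : R), 0 < e -> exists2 b, normc (b - z) < e & f' b = 0) ->
  forall z, f z = f 0.
Proof.
move=> df dense.
have f'0 a : f' a = 0.
  apply: eq0_normc; apply/eqP; rewrite eq_le normc_ge0 andbT.
  apply/ler_addgt0Pl => e e0; rewrite addr0.
  have e2 : 0 < e / 2 by rewrite divr_gt0.
  have cf z := cderiv_continuous (df z).
  (* This square contains the closed unit disc around [a], on which [g] must be small. *)
  have [d d0 dP] := @uniform_continuity_square f (Re a - 1) (Im a - 1) 2 _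
    (ltr0Sn R 1) e2 cf.
  have [b ba b0] := dense a _ d0.
  (* As [f' b = 0], the derivative of [g] at [a] is [- f' a], so the Cauchy estimate for [g] bounds
     [f' a]. *)
  pose g z := f (z + (b - a)) - f z.
  have dg z : cderiv g z (f' (z + (b - a)) - f' z).
    apply: cderivB (df z); rewrite -[f' (_ + _)]mulr1.
    apply: (@cderiv_comp _ f (fun z => z + (b - a))) (df _).
    under [X in cderiv X]eq_fun do rewrite addrC.
    exact: cderiv_translation.
  have := @Cauchy_estimate g _ a e dg.
  rewrite (addrC a) subrK b0 sub0r normcNE; apply=> u u1.
  have near_a (w : R[i]) : normc (w - a) <= 1 -> normc (g w) <= e / 2.
    move=> wa; case: w wa => t s wa; apply: dP => //.
      have := le_trans (normc_Re _) wa.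
    by rewrite (_ : Re _ = t - Re a); [rewrite ler_distl; lra|case: (a)].
    have := le_trans (normc_Im _) wa.
    by rewrite (_ : Im _ = s - Im a); [rewrite ler_distl; lra|case: (a)].
  have := near_a (a + u); rewrite (addrC a u) addrK u1 => /(_ (lexx _)).
  have := near_a a; rewrite subrr normc0 => /(_ ler01).
  have := normcB (g (u + a)) (g a); lra.
move=> z; apply/eqP; rewrite -subr_eq0; apply/eqP/eq0_normc/eqP.
rewrite eq_le normc_ge0 andbT.
have := @rderiv_bound R (fun t => f (0 + z * t%:C)) 0 1 0 ler01.
rewrite mul0r rmorph1 rmorph0 mulr1 mulr0 !add0r; apply => t _.
exists 0; last by rewrite normc0.
have dz : cderiv f (0 + z * t%:C) 0.
  by have := df (0 + z * t%:C); rewrite f'0.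
by have := cderiv_line dz; rewrite mul0r.
Qed.

End CauchyEstimate.

(** * Entire functions and small sets *)

Section Reals.
Context (R : realType).

(** A complex number is determined by the rational cuts of its two coordinates, coded together as
    one set of natural numbers. *)
Lemma card_le_continuum (X : set R[i]) : X #<= continuum.
Proof.
pose cut (z : R[i]) : set nat := [set n |
  match unpickle n : option (rat + rat) with
  | Some (inl q) => ratr q < Re z
  | Some (inr q) => ratr q < Im z
  | None => False
  end].
have rat_lt (x y : R) : (forall q, ratr q < x <-> ratr q < y) -> x <= y.
  move=> xy; rewrite leNgt; apply/negP => /rat_in_itvoo[q].
  rewrite in_itv /= => /andP[yq /xy qy].
  by have := lt_trans yq qy; rewrite ltxx.
apply: (@card_le_inj _ _ _ _ cut) => // z w _ _ e.
have cutE u (p : rat + rat) : cut u (pickle p) =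
    match p with inl q => ratr q < Re u | inr q => ratr q < Im u end.
  by rewrite /cut /mkset pickleK.
have re q : ratr q < Re z <-> ratr q < Re w.
  by have := cutE z (inl q); rewrite e cutE => ->.
have im q : ratr q < Im z <-> ratr q < Im w.
  by have := cutE z (inr q); rewrite e cutE => ->.
clear e cutE.
case: z w re im => a b [c d] /= re im; congr Complex; apply/le_anti.
  by rewrite !rat_lt // => q; split=> /re.
by rewrite !rat_lt // => q; split=> /im.
Qed.

(** Each point is alone in [S] within some interval with rational endpoints, and these endpoints
    determine it. *)
Lemma countable_isolated (S : set R) :
  (forall x, S x -> exists2 e : R, 0 < e & forall y, S y -> `|y - x| < e -> y = x) ->
  countable S.
Proof.
move=> iso.
have /choice[b bP] : forall x, exists p : rat * rat, S x ->
    ratr p.1 < x < ratr p.2 /\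
    forall y, S y -> ratr p.1 < y < ratr p.2 -> y = x.
  move=> x; have [/iso[e e0 eP]|nS] := pselect (S x); last by exists (0, 0).
  have [p /itvP p_] := @rat_in_itvoo R (x - e) x ltac:(lra).
  have [q /itvP q_] := @rat_in_itvoo R x (x + e) ltac:(lra).
  exists (p, q) => _; split=> /= [|y Sy /andP[py yq]]; first by rewrite p_ q_.
  apply: eP => //; rewrite ltr_distl (lt_trans _ py) ?p_ //.
  by rewrite (lt_trans yq) // q_.
apply: (@sub_countable _ _ _ [set: rat * rat]); last exact: countableP.
apply: (@card_le_inj _ _ _ _ b) => // x y /set_mem Sx /set_mem Sy e.
have [_ xP] := bP x Sx; have [yb _] := bP y Sy.
by apply/esym/xP => //; rewrite e.
Qed.

Lemma scale_le m n : (m <= n)%N -> scale R n <= scale R m.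
Proof.
move=> mn; rewrite -(subnKC mn); elim: (n - m)%N => [|k IH]; first by rewrite addn0.
by rewrite addnS scaleS; have := scale_gt0 R (m + k); lra.
Qed.

(* X consists of rational translates of qval of subsets of the scales m k, so that
   its distances are comparable to the scales avoided by f(X) in each piece. *)
Lemma no_entire_map (T : Type) (A : set T) (m : nat -> nat) (Z : nat -> set R[i])
    (Y : set R[i]) :
  ~ countable A -> card_lt A continuum ->
  (forall k, (k <= m k)%N) ->
  (forall k a b, Z k a -> Z k b ->
        k.+1%:R * normc (a - b) < scale R (m k) \/
        k.+1%:R * scale R (m k) < normc (a - b)) ->
  (forall y, Y y -> exists n, forall k, (n <= k)%N -> Z k y) ->
  exists2 X : set R[i], card_lt X continuum &
    forall f, entire f -> f @` X `<=` Y -> exists c, forall z, f z = c.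
Proof.
move=> uncA [Ac cA] mk gap YZ.
have [a0 Aa0] : A !=set0.
  by apply/set0P/eqP => A0; apply: uncA; rewrite A0; exact: countable0.
have [i [_ iinj]] := card_le_fun Aa0 Ac.
(* A strictly increasing sequence of values of [m], which itself need not be injective. *)
pose j n := iter n (fun k => m k.+1) (m 0).
have jm n : range m (j n) by case: n => [|n]; [exists 0%N|exists (j n).+1].
have jinj : injective j.
  apply: incn_inj; apply: leq_mono; apply: homo_ltn => [? ? ?|n]; first exact: ltn_trans.
  exact: mk.
pose x t : R := qval R (j @` i t).
have xinj : {in A &, injective x}.
  move=> s t sA tA /qval_inj e; apply: iinj => //.
  by apply/funext => k; rewrite -(image_inj (A := i s) jinj) e (image_inj jinj).
pose X0 := x @` A.
have uncX0 : ~ countable X0.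
  apply: contra_not uncA; apply: sub_countable.
  by apply: (@card_le_inj _ _ _ _ x) => // t At; exists t.
have gapX0 a b : X0 a -> X0 b -> a <> b -> exists k,
    2 / 3 * scale R (m k) <= `|a - b| <= 4 / 3 * scale R (m k).
  move=> [s As <-] [t At <-] ab.
  have [|d sd dP] := @qval_dist R (j @` i s) (j @` i t).
    by move=> e; apply: ab; rewrite /x e.
  have [k _ ek] : range m d by case: sd => -[l _ <-]; exact: jm.
  by exists k; rewrite ek.
(* The translations by rational complex numbers; numbers that code nothing give the translation by
   0. *)
pose tr n (a : R) : R[i] := a%:C + ratc R (odflt (0, 0) (unpickle n)).
exists (\bigcup_n tr n @` X0).
  split; first exact: card_le_continuum.
  move=> /continuum_bigcup[n h]; apply: cA.
  by apply: card_le_trans h _; do 2!apply: (card_le_trans (card_image_le _ _)).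
move=> f entf fXY; have [f' df] := entire_cderiv entf.
apply: contrapT => ncst.
have [z0 [e0 e0_gt0 nz]] : exists z0, exists2 e0 : R, 0 < e0 &
    forall b, normc (b - z0) < e0 -> f' b <> 0.
  apply: contrapT => nex; apply: ncst; exists (f 0).
  apply: (entire_dense_critical df) => z e e_gt0; apply: contrapT => nb.
  by apply: nex; exists z, e => // b bz b0; apply: nb; exists b.
(* Countably many pieces: the translate by [p.1] is mapped into every [Z k] from index [p.2] on. *)
pose W (p : (rat * rat) * nat) := [set a | X0 a /\
  forall k, (p.2 <= k)%N -> Z k (f (a%:C + ratc R p.1))].
have WP a q : X0 a -> exists n, W (q, n) a.
  move=> Xa; have [|n nP] := YZ (f (a%:C + ratc R q)); last by exists n.
  apply: fXY; exists (a%:C + ratc R q) => //; exists (pickle q) => //.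
  by exists a => //; rewrite /tr pickleK.
pose iso p := [set a | W p a /\ exists2 e : R, 0 < e &
  forall b, W p b -> `|b - a| < e -> b = a].
have iso_countable p : countable (iso p).
  apply: countable_isolated => a [_ [e e_gt0 eP]].
  by exists e => // b [Wb _]; exact: eP.
(* The points isolated in some piece form a countable set, so some [a] in the uncountable [X0] is
   isolated in no piece containing it. *)
have [a Xa na] : exists2 a, X0 a & forall p, W p a -> forall e : R, 0 < e ->
    exists b, [/\ W p b, `|b - a| < e & b <> a].
  apply: contrapT => nex; apply: uncX0.
  apply: (@sub_countable _ _ _ (\bigcup_p iso p)); last first.
    by apply: bigcup_countable => //; exact: countableP.
  apply: subset_card_le => a Xa; apply: contrapT => nia; apply: nex; exists a => //.
  move=> p Wpa e e_gt0; apply: contrapT => nb; apply: nia; exists p => //.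
  split=> //; exists e => // b Wb ba; apply: contrapT => nba.
  by apply: nb; exists b.
(* A rational translation moves [a] into the disc free of critical points. *)
have [q qP] := ratc_dense (z0 - a%:C) e0_gt0.
pose c := a%:C + ratc R q.
have {qP} c_crit : f' c <> 0.
  by apply: nz; rewrite normc_distC /c opprD addrA.
have [n Wa] := WP a q Xa.
pose p := normc (f' c).
have p_gt0 : 0 < p by rewrite normc_gt0; exact/eqP.
have p2 : 0 < p / 2 by rewrite divr_gt0.
have [d d_gt0 dP] := df c _ p2.
(* The increment of [f] lies between [p / 2] and [3 / 2 * p] times [|b - a|], which is itself
   between [2 / 3] and [4 / 3] of a scale [s]. It is thus between [p * s / 3] and [2 * p * s],
   inside the forbidden interval once [k.+1 * p >= 3] and [k.+1 >= 2 * p]. *)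
pose B := 2 * p + 3 / p.
have B_ge0 : 0 <= B by rewrite addr_ge0 ?mulr_ge0 ?invr_ge0 // ltW.
pose N := maxn n (Num.bound B).
have BN k : (N <= k)%N -> 2 * p <= k.+1%:R /\ 3 <= k.+1%:R * p.
  rewrite geq_max => /andP[_ Bk].
  have kB : B < k.+1%:R :> R.
    by rewrite (lt_le_trans (archi_boundP B_ge0)) // ler_nat leqW.
  have p3 : 0 < 3 / p by rewrite divr_gt0.
  move: kB; rewrite /B => kB; split; first by lra.
  by rewrite -ler_pdivrMr //; lra.
(* Distances below [2 / 3 * scale R M] exclude all scales of index below [N], forcing [k >= N]. *)
pose M := (\max_(l < N) m l)%N.
have e_gt0 : 0 < Order.min d (2 / 3 * scale R M).
  by rewrite lt_min d_gt0 mulr_gt0 ?scale_gt0 // divr_gt0.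
have [b [Wb]] := na (q, n) Wa _ e_gt0.
rewrite lt_min => /andP[bd bM] ba.
have [k kP] := gapX0 b a Wb.1 Xa ba.
have Nk : (N <= k)%N.
  rewrite leqNgt; apply/negP => kN.
  have : scale R M <= scale R (m k).
    by apply: scale_le; exact: (leq_bigmax (F := fun l : 'I_N => m l) (Ordinal kN)).
  lra.
have nk : (n <= k)%N by rewrite (leq_trans _ Nk) // leq_maxl.
have [K2 K3] := BN k Nk.
have := gap k _ _ (Wb.2 k nk) (Wa.2 k nk); rewrite /= -/c.
have := dP (b - a)%:C; rewrite normc_real => /(_ bd).
rewrite (_ : c + (b - a)%:C = b%:C + ratc R q); last by rewrite /c rmorphB; ring.
set D := f _ - f c => hD.
have h1 : normc D <= 3 / 2 * p * `|b - a|.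
  have := normcD (D - f' c * (b - a)%:C) (f' c * (b - a)%:C).
  by rewrite subrK normcM normc_real -/p; lra.
have h2 : p / 2 * `|b - a| <= normc D.
  have := normc_dist (f' c * (b - a)%:C) D.
  by rewrite normc_distC normcM normc_real -/p; lra.
have s_gt0 := scale_gt0 R (m k).
set K := k.+1%:R in K2 K3 *; set s := scale R (m k) in kP s_gt0 *.
have K0 : 0 <= K by exact: ler0n.
case=> h.
  have : p / 2 * (2 / 3 * s) <= p / 2 * `|b - a| by apply: ler_wpM2l; lra.
  move=> /le_trans/(_ h2)/(ler_wpM2l K0).
  have : 3 * s <= K * p * s by rewrite ler_wpM2r // ltW.
  lra.
have : 3 / 2 * p * `|b - a| <= 3 / 2 * p * (4 / 3 * s) by apply: ler_wpM2l; lra.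
have : 2 * p * s <= K * s by rewrite ler_wpM2r // ltW.
lra.
Qed.

End Reals.

Theorem theorem6p5 (R : realType) :
  Martin_axiom -> aleph1_lt_continuum ->
  ~ exists Y : set R[i], universal Y.
Proof.
move=> MA [T [A [[uncA _] Ac]]] [Y [Yc univ]].
have [m [Z [mk gap YZ]]] := Martin_gaps MA Yc.
have [X Xc const] := no_entire_map uncA Ac mk gap YZ.
have [f [entf ncst fXY]] := univ X Xc.
exact: ncst (const f entf fXY).
Qed.
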